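(* Let $G=(V,P,d)$ be a reversible metric Markov chain with non-negative Ollivier curvature, where $d$ is the combinatorial distance. Let $\rho>0$ and assume that for every $A\subset V$ with $m(A)\ge\frac12$ and every $r>0$, \[ m(V\setminus A_r)\le\exp(-\rho r^2),\qquad A_r=\{x:d(x,A)\le r\}. \] Then $h_{\sqrt{\log}}\ge\frac{P_0}{48}\sqrt\rho$.
   Context: $V$ finite; $P$ with symmetric support, connected; $x\sim y$ iff $x\ne y$, $P(x,y)>0$; $d(x,y)$ is the minimal number of edges on a path; $m$ the probability with $m(x)P(x,y)=m(y)P(y,x)$. $\Delta f(x)=\sum_yP(x,y)(f(y)-f(x))$; Ollivier curvature $\kappa(x,y)=\inf\{(\Delta f(x)-\Delta f(y))/d(x,y): f\ 1\text{-Lipschitz},\ f(y)-f(x)=d(x,y)\}\ge0$ for all $x\sim y$. $P_0=\inf_{x\sim y}P(x,y)d(x,y)^2$. $|\partial W|=\sum_{x\in W,y\notin W}P(x,y)m(x)d(x,y)$. $h_{\sqrt{\log}}=\inf\{|\partial W|/(m(W)\sqrt{\log(1/m(W))}): W\ne\emptyset,\ m(W)\le\frac12\}$. *)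

(* Defs.v *)
From HB Require Import structures.
From mathcomp Require Import all_boot all_order all_algebra.
From mathcomp Require Import all_classical all_reals all_analysis.
Set Implicit Arguments. Unset Strict Implicit. Unset Printing Implicit Defensive.
Import Order.TTheory GRing.Theory Num.Theory.
Local Open Scope ring_scope.
Local Open Scope classical_set_scope.

Section MetricMarkovChain.
Variables (R : realType) (V : finType) (P : V -> V -> R).

Definition adj (x y : V) : bool := (x != y) && (0 < P x y).

Fixpoint walk (n : nat) (x y : V) : bool :=
  if n is n'.+1 then [exists z, adj x z && walk n' z y] else x == y.

Definition connected_chain : Prop := forall x y : V, exists n, walk n x y.

(* combinatorial distance: least number of edges of a path from x to y.
   (On a connected graph a shortest path has < #|V| edges, so searching
   n in 0..#|V|-1 is exhaustive.) *)
Definition gdist (x y : V) : nat := find (fun n => walk n x y) (iota 0 #|V|).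

Definition markov_kernel : Prop :=
  (forall x y, 0 <= P x y) /\ (forall x, \sum_(y : V) P x y = 1).

Definition symmetric_support : Prop := forall x y, (0 < P x y) <-> (0 < P y x).

Variable m : V -> R.

Definition reversible_prob : Prop :=
  (forall x, 0 <= m x) /\ \sum_(x : V) m x = 1 /\
  (forall x y, m x * P x y = m y * P y x).

Definition mass (A : {set V}) : R := \sum_(x in A) m x.

Definition Lap (f : V -> R) (x : V) : R := \sum_(y : V) P x y * (f y - f x).

Definition one_lipschitz (f : V -> R) : Prop :=
  forall u v, `|f u - f v| <= (gdist u v)%:R.

Definition ollivier (x y : V) : \bar R :=
  ereal_inf ((fun f : V -> R => ((Lap f x - Lap f y) / (gdist x y)%:R)%:E) @`
    [set f | one_lipschitz f /\ f y - f x = (gdist x y)%:R]).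

Definition nonneg_curvature : Prop :=
  forall x y, adj x y -> (0 <= ollivier x y)%E.

Definition P0 : \bar R :=
  ereal_inf ((fun xy : V * V => (P xy.1 xy.2 * ((gdist xy.1 xy.2)%:R) ^+ 2)%:E) @`
    [set xy | adj xy.1 xy.2]).

Definition boundary (W : {set V}) : R :=
  \sum_(x in W) \sum_(y in ~: W) P x y * m x * (gdist x y)%:R.

Definition h_sqrtlog : \bar R :=
  ereal_inf ((fun W : {set V} =>
      (boundary W / (mass W * Num.sqrt (ln ((mass W)^-1))))%:E) @`
    [set W : {set V} | W != finset.set0 /\ mass W <= 2^-1]).

Definition enlarge (A : {set V}) (r : R) : {set V} :=
  [set x | [exists a in A, (gdist x a)%:R <= r]].

Definition gaussian_concentration (rho : R) : Prop :=
  forall A : {set V}, 2^-1 <= mass A ->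
  forall r : R, 0 < r -> mass (~: enlarge A r) <= expR (- (rho * r ^+ 2)).

End MetricMarkovChain.

(* Main.v *)
(** Fix [W] with [eps = m(W) <= 1/2]. Non-negative curvature makes the lazy step
    [f + Lap f / 2] preserve 1-Lipschitz functions. Composing it with the maximal
    1-Lipschitz extension from [W] gives a monotone map commuting with constants;
    an (approximate) eigenfunction [f] of it is 1-Lipschitz with [Lap f >= C] on
    [W], [Lap f <= C] everywhere, and every point outside [W] has a neighbour
    where [f] is smaller by 1. Integrating over [W], [C * eps <= boundary W], so it
    remains to bound [C] from below. Test [Lap f <= C] against [psi (f)], where
    [psi] is 1 below the [eps/4]-quantile [s] of [f] and decays like
    [exp (- lam t)] above it: with [A] the integral of [psi (f)] over the points
    outside [W] where [f >= s], Green's formula gives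
    [P0 * lam * A <= C * (A + 5/4 * eps)]. Concentration, used twice, confines [f]
    to height [s + 2 r] with [r] of order [sqrt (ln (1/eps) / rho)] up to mass
    [eps/4], so [A >= eps/4] for [lam] of order [sqrt (rho * ln (1/eps))], and
    hence [C >= P0 * lam / 6]. *)

Require Import Defs.
From HB Require Import structures.
From mathcomp Require Import all_boot all_order all_algebra.
From mathcomp Require Import all_classical all_reals all_analysis.
From mathcomp Require Import ring lra.
Set Implicit Arguments.
Unset Strict Implicit.
Unset Printing Implicit Defensive.
Import Order.TTheory GRing.Theory Num.Theory.
Local Open Scope ring_scope.

(** * Walks, combinatorial distance and Lipschitz functions *)

Section GraphDistance.
Variables (R : realType) (V : finType) (P : V -> V -> R).
Hypotheses (Psym : symmetric_support P) (Pconn : connected_chain P).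

Local Notation adj := (adj P).
Local Notation walk := (walk P).
Local Notation d := (gdist P).

Lemma adjC x y : adj x y = adj y x.
Proof.
rewrite /Defs.adj eq_sym; congr (_ && _).
by apply/idP/idP => /Psym.
Qed.

Lemma walkS n x y : walk n.+1 x y = [exists z, adj x z && walk n z y].
Proof. by []. Qed.

Lemma walkD a b x y z : walk a x y -> walk b y z -> walk (a + b) x z.
Proof.
elim: a x => [|a IH] x; first by rewrite add0n /= => /eqP ->.
rewrite addSn !walkS => /existsP[w /andP[xw wy]] yz.
by apply/existsP; exists w; rewrite xw; exact: IH wy yz.
Qed.

Lemma walk1 x y : adj x y -> walk 1 x y.
Proof. by move=> xy; rewrite walkS; apply/existsP; exists y; rewrite xy /=. Qed.

Lemma walkC n x y : walk n x y -> walk n y x.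
Proof.
elim: n x => [|n IH] x; first by rewrite /= eq_sym.
rewrite walkS => /existsP[z /andP[xz /IH zy]].
by rewrite -addn1; apply: walkD zy _; apply: walk1; rewrite adjC.
Qed.

Lemma walkP n x y :
  reflect (exists p, [/\ path adj x p, last x p = y & size p = n]) (walk n x y).
Proof.
elim: n x => [|n IH] x.
  apply: (iffP eqP) => [->|[p [_ <- /size0nil ->]]] //.
  by exists [::].
rewrite walkS; apply: (iffP existsP).
  move=> [z /andP[xz /IH [p [zp py pn]]]].
  by exists (z :: p); rewrite /= xz zp py pn.
move=> [[|z p] [//= /andP[xz zp] py [pn]]].
by exists z; rewrite xz; apply/IH; exists p.
Qed.

Lemma gdist_le n x y : walk n x y -> (d x y <= n)%N.
Proof.
move=> nxy; rewrite /gdist leqNgt; apply/negP => lt_n.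
have n_lt : (n < #|V|)%N.
  by apply: leq_trans lt_n _; rewrite -[X in (_ <= X)%N](size_iota 0) find_size.
by have := before_find 0 lt_n; rewrite nth_iota // add0n nxy.
Qed.

(** Removing repeated vertices from a path leaves fewer than [#|V|] edges, so the bounded search in
    [gdist] succeeds. *)
Lemma has_short_walk x y : has (fun n => walk n x y) (iota 0 #|V|).
Proof.
have [n /walkP [p [xp py _]]] := Pconn x y.
case/shortenP: xp py => p' xp' Up' _ py.
apply/hasP; exists (size p'); last by apply/walkP; exists p'.
by rewrite mem_iota add0n /= -[(_ < _)%N]/(size (x :: p') <= _)%N -(card_uniqP Up') max_card.
Qed.

Lemma gdist_walk x y : walk (d x y) x y.
Proof.
have h := has_short_walk x y; have := nth_find 0 h.
by rewrite nth_iota ?add0n //; rewrite has_find size_iota in h.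
Qed.

Lemma gdist_le_card x y : (d x y <= #|V|)%N.
Proof. by rewrite /gdist -[X in (_ <= X)%N](size_iota 0) find_size. Qed.

Lemma gdistxx x : d x x = 0.
Proof. by apply/eqP; rewrite -leqn0; apply: gdist_le => /=. Qed.

Lemma gdist_gt0 x y : (0 < d x y)%N = (x != y).
Proof.
have [->|xy] := eqVneq x y; first by rewrite gdistxx.
by rewrite lt0n; apply: contra xy => /eqP d0; have := gdist_walk x y; rewrite d0.
Qed.

Lemma gdistC x y : d x y = d y x.
Proof. by apply/eqP; rewrite eqn_leq !gdist_le // walkC // gdist_walk. Qed.

Lemma gdist_triangle y x z : (d x z <= d x y + d y z)%N.
Proof. by apply/gdist_le/(walkD (y := y)); exact: gdist_walk. Qed.

Lemma adj_gdist x y : adj x y -> d x y = 1%N.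
Proof.
move=> xy; apply/eqP; rewrite eqn_leq gdist_le ?walk1 //=.
by rewrite gdist_gt0; case/andP: xy.
Qed.

Lemma gdist_step x y : x != y -> exists2 z, adj x z & d x y = (d z y).+1.
Proof.
rewrite -gdist_gt0; have := gdist_walk x y.
case dE: (d x y) => [//|n]; rewrite walkS => /existsP[z /andP[xz zy]] _.
exists z => //; apply/eqP; rewrite eqSS eqn_leq gdist_le // andbT.
by rewrite -ltnS -dE -add1n -(adj_gdist xz) gdist_triangle.
Qed.

Lemma lip_adj (f : V -> R) :
  (forall x y, adj x y -> f y - f x <= 1) -> one_lipschitz P f.
Proof.
move=> f1.
have f_walk n x y : walk n x y -> f y - f x <= n%:R.
  elim: n x => [|n IH] x; first by move=> /= /eqP ->; rewrite subrr.
  rewrite walkS => /existsP[z /andP[/f1 xz /IH zy]].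
  by rewrite -natr1; lra.
move=> x y; rewrite ler_norml lerNl opprB f_walk ?gdist_walk //.
by rewrite gdistC f_walk ?gdist_walk.
Qed.

Lemma lipP (f : V -> R) x y : one_lipschitz P f -> f x <= f y + (d x y)%:R.
Proof. by move=> /(_ x y); rewrite ler_norml => /andP[_]; lra. Qed.

Lemma lip_max (f g : V -> R) : one_lipschitz P f -> one_lipschitz P g ->
  one_lipschitz P (fun x => Num.max (f x) (g x)).
Proof.
move=> fL gL; apply: lip_adj => x y /adj_gdist xy.
rewrite lerBlDl ge_max //.
apply/andP; split; rewrite addrC -lerBlDl -[1]/(1%:R) -xy gdistC.
  by have := lipP y x fL; rewrite le_max //; lra.
by have := lipP y x gL; rewrite le_max //; lra.
Qed.

Lemma lip_gdist (c : R) y : one_lipschitz P (fun x => c - (d x y)%:R).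
Proof.
apply: lip_adj => x z xz.
have := gdist_triangle z x y; rewrite (adj_gdist xz) -(ler_nat R) natrD; lra.
Qed.

End GraphDistance.

(** * Lipschitz extension from a subset *)

Section MinimalExtension.
Variables (R : realType) (V : finType) (P : V -> V -> R).
Hypotheses (Psym : symmetric_support P) (Pconn : connected_chain P).
Variables (W : {set V}) (k0 : V).
Hypothesis k0W : k0 \in W.

Local Notation d := (gdist P).

(* The largest 1-Lipschitz extension to [V] of the restriction of [g] to [W]. *)
Definition lip_ext (g : V -> R) (y : V) : R :=
  let k := [arg min_(k < k0 | k \in W) (g k + (d y k)%:R)]%O in
  g k + (d y k)%:R.

Lemma lip_ext_le g y k : k \in W -> lip_ext g y <= g k + (d y k)%:R.
Proof. by rewrite /lip_ext; case: arg_minP => // i _ le_i /le_i. Qed.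

Lemma lip_ext_ex g y : exists2 k, k \in W & lip_ext g y = g k + (d y k)%:R.
Proof. by rewrite /lip_ext; case: arg_minP => // i iW _; exists i. Qed.

Lemma lip_ext_lip g : one_lipschitz P (lip_ext g).
Proof.
apply: lip_adj => // x y xy; have [k kW ->] := lip_ext_ex g x.
have := lip_ext_le g y kW; have := gdist_triangle Pconn x y k.
by rewrite (gdistC Psym Pconn y x) (adj_gdist Pconn xy) -(ler_nat R) natrD; lra.
Qed.

Lemma lip_ext_ge g y : one_lipschitz P g -> g y <= lip_ext g y.
Proof. by move=> gL; have [k kW ->] := lip_ext_ex g y; exact: lipP. Qed.

Lemma lip_ext_id g y : one_lipschitz P g -> y \in W -> lip_ext g y = g y.
Proof.
move=> gL yW; apply/eqP; rewrite eq_le lip_ext_ge // andbT.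
by have := lip_ext_le g y yW; rewrite gdistxx addr0.
Qed.

(** The constant [c] encodes monotonicity and commutation with constants at once; the minimiser for
    [g] is a competitor for [f]. *)
Lemma lip_ext_homo f g c :
  (forall x, f x <= g x + c) -> forall x, lip_ext f x <= lip_ext g x + c.
Proof.
move=> fg x; have [k kW ->] := lip_ext_ex g x.
by have := lip_ext_le f x kW; have := fg k; lra.
Qed.

(** The minimising point of [W] differs from [y]; the first step of a geodesic towards it lowers the
    extension by at least 1. *)
Lemma lip_ext_descent g y : y \notin W ->
  exists2 z, adj P y z & lip_ext g z <= lip_ext g y - 1.
Proof.
move=> yW; have [k kW ->] := lip_ext_ex g y.
have [|z yz dE] := gdist_step Pconn (x := y) (y := k).
  by apply: contra yW => /eqP ->.
exists z => //; have := lip_ext_le g z kW; rewrite dE -natr1; lra.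
Qed.

End MinimalExtension.

(** * Curvature and the lazy averaging step *)

Section LazyStep.
Variables (R : realType) (V : finType) (P : V -> V -> R).
Hypotheses (Pker : markov_kernel P) (Psym : symmetric_support P).
Hypotheses (Pconn : connected_chain P) (curv : nonneg_curvature P).

Local Notation d := (gdist P).

Definition lazy_step (f : V -> R) (x : V) : R := f x + Lap P f x / 2.

Lemma LapE (f : V -> R) x : Lap P f x = \sum_y P x y * f y - f x.
Proof.
rewrite /Lap; under eq_bigr do rewrite mulrBr.
by rewrite sumrB -mulr_suml Pker.2 mul1r.
Qed.

Lemma kernel_avg_le (f g : V -> R) x c : (forall y, f y <= g y + c) ->
  \sum_y P x y * f y <= \sum_y P x y * g y + c.
Proof.
move=> fg; rewrite -[c]mul1r -(Pker.2 x) mulr_suml -big_split /=.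
by apply: ler_sum => y _; rewrite -mulrDr ler_wpM2l ?Pker.1.
Qed.

Lemma lazy_step_homo f g c :
  (forall x, f x <= g x + c) -> forall x, lazy_step f x <= lazy_step g x + c.
Proof.
move=> fg x; rewrite /lazy_step !LapE.
by have := kernel_avg_le x fg; have := fg x; lra.
Qed.

Lemma curvature_Lap x y (f : V -> R) : adj P x y -> one_lipschitz P f ->
  f y - f x = 1 -> Lap P f y <= Lap P f x.
Proof.
move=> xy fL fxy; rewrite -subr_ge0 -lee_fin.
apply: le_trans (curv xy) _; apply: ereal_inf_lbound; exists f.
  by split=> //; rewrite (adj_gdist Pconn xy).
by rewrite (adj_gdist Pconn xy) divr1.
Qed.

(* The curvature condition only concerns [f] of maximal slope on the edge
   [x y]; if [f] misses the maximal slope by [eta], raise it to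
   [f' = max (f, f y + eta - d(., y))], which is within [eta] of [f] and has
   the same value at [x]. *)
Lemma lazy_step_lip f : one_lipschitz P f -> one_lipschitz P (lazy_step f).
Proof.
move=> fL; apply: lip_adj => // x y xy.
have dxy := adj_gdist Pconn xy.
pose eta := 1 - (f y - f x).
have eta0 : 0 <= eta by have := lipP y x fL; rewrite gdistC // dxy /eta; lra.
pose f' z := Num.max (f z) (f y + eta - (d z y)%:R).
have f'L : one_lipschitz P f' by apply: lip_max => //; exact: lip_gdist.
have f'x : f' x = f x by rewrite /f' dxy /eta; apply/max_idPl; lra.
have f'y : f' y = f y + eta.
  by rewrite /f' gdistxx // subr0; apply/max_idPr; lra.
have ff' z : f z <= f' z <= f z + eta.
  rewrite le_max lexx /= ge_max; apply/andP; split; first lra.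
  by have := lipP y z fL; rewrite gdistC //; lra.
have := curvature_Lap xy f'L; rewrite f'x f'y /eta => /(_ ltac:(lra)).
(* The averages of [f] at [y] and [x] differ by at most [1 + eta], the values of [f] by [1 - eta];
   the factor 1/2 in the lazy step balances the two to 1. *)
rewrite /lazy_step !LapE f'x f'y.
have h1 : \sum_z P y z * f z <= \sum_z P y z * f' z + 0.
  by apply: kernel_avg_le => z; have := ff' z; lra.
have h2 : \sum_z P x z * f' z <= \sum_z P x z * f z + eta.
  by apply: kernel_avg_le => z; have := ff' z; lra.
by rewrite /eta in h2 *; lra.
Qed.

End LazyStep.

(** * Approximate eigenfunctions of monotone maps *)

Section ApproximateEigenfunction.
Variables (R : realType) (V : finType) (P : V -> V -> R).
Variables (x0 : V) (T : (V -> R) -> V -> R).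
Hypothesis T_lip : forall f, one_lipschitz P f -> one_lipschitz P (T f).
Hypothesis T_homo : forall f g c,
  (forall x, f x <= g x + c) -> forall x, T f x <= T g x + c.

Lemma lip_range f : one_lipschitz P f ->
  exists a, forall x, a <= f x <= a + #|V|%:R.
Proof.
move=> fL; have [z _ zmin] := @arg_minP _ _ _ x0 xpredT f isT.
exists (f z) => x; rewrite zmin //=; apply: le_trans (lipP x z fL) _.
by rewrite lerD2l ler_nat gdist_le_card.
Qed.

Lemma lip_scale f q : 0 <= q <= 1 -> one_lipschitz P f ->
  one_lipschitz P (fun x => q * f x).
Proof.
move=> /andP[q0 q1] fL x y; rewrite -mulrBr normrM ger0_norm //.
by apply: le_trans (fL x y); rewrite ler_piMl.
Qed.

(* For [q < 1] the map [q T] contracts the oscillation, so its iterates [f]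
   almost satisfy [q T f = f + const]; the defect [(1 - q) T f] has small
   oscillation because [T f] is 1-Lipschitz. *)
Lemma approx_eigenfunction del : 0 < del ->
  exists2 f, one_lipschitz P f &
    exists c, forall x, c <= T f x - f x <= c + del.
Proof.
move=> del0; pose D : R := #|V|%:R; have D0 : 0 <= D by exact: ler0n.
(* Small enough that [t * T f], of oscillation at most [t * D], uses only half of [del]; the other
   half goes to [q ^+ k * D]. *)
pose t := del / (del + 2 * D + 2).
have den0 : 0 < del + 2 * D + 2 by lra.
have t0 : 0 < t by rewrite divr_gt0.
have t1 : t < 1 by rewrite /t ltr_pdivrMr //; lra.
have tD : t * D <= del / 2.
  by rewrite /t mulrAC ler_pdivrMr //; nra.
pose q := 1 - t; have q01 : 0 <= q <= 1 by rewrite /q; apply/andP; split; lra.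
have q0 : 0 <= q by case/andP: q01.
pose F k := iter k (fun f x => q * T f x) (fun=> 0).
have FL k : one_lipschitz P (F k).
  elim: k => [|k IH]; first by move=> x y; rewrite subrr normr0 ler0n.
  exact: lip_scale (T_lip IH).
have F_osc k : exists a, forall x, a <= F k.+1 x - F k x <= a + q ^+ k * D.
  elim: k => [|k [a Ha]].
    have [a Ha] := lip_range (FL 1).
    by exists a => x; have := Ha x; rewrite expr0 mul1r [F 0]/F /= subr0.
  exists (q * a) => x.
  have up : T (F k.+1) x <= T (F k) x + (a + q ^+ k * D).
    by apply: T_homo => y; have := Ha y; lra.
  have dn : T (F k) x <= T (F k.+1) x + - a.
    by apply: T_homo => y; have := Ha y; lra.
  have -> : F k.+2 x - F k.+1 x = q * (T (F k.+1) x - T (F k) x).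
    by rewrite mulrBr.
  rewrite exprS -mulrA -mulrDr; apply/andP; split; apply: ler_wpM2l => //; lra.
have [k qk] : exists k, q ^+ k * D <= del / 2.
  have q1 : `|q| < 1 by rewrite ger0_norm // /q; lra.
  have e0 : 0 < del / 2 / (D + 1) by rewrite !divr_gt0 //; lra.
  have /cvgrPdist_lt /(_ _ e0) [N _ /(_ N (leqnn N))] := cvg_expr q1.
  rewrite sub0r normrN ger0_norm ?exprn_ge0 // ltr_pdivlMr; last lra.
  by move=> h; exists N; have := exprn_ge0 N q0; nra.
exists (F k) => //; have [a Ha] := F_osc k.
have [b Hb] := lip_range (T_lip (FL k)).
exists (a + t * b) => x; have -> : T (F k) x - F k x =
    (F k.+1 x - F k x) + t * T (F k) x.
  have -> : F k.+1 x = q * T (F k) x by [].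
  by move: (T _ x) (F k x) => u v; rewrite /q; ring.
have {Ha} := Ha x; have := Hb x; rewrite -/D => /andP[b1 b2] /andP[a1 a2].
by apply/andP; split; nra.
Qed.

End ApproximateEigenfunction.

(** * Separation of the Laplacian by a set *)

Section Separation.
Variables (R : realType) (V : finType) (P : V -> V -> R).
Hypotheses (Pker : markov_kernel P) (Psym : symmetric_support P).
Hypotheses (Pconn : connected_chain P) (curv : nonneg_curvature P).

(* [T f], the extension from [W] of the lazy step of [f], agrees with the lazy
   step on [W] and is at least the lazy step elsewhere; so for an approximate
   eigenfunction the Laplacian is almost constant on [W] and not larger outside. *)
Lemma laplacian_separation (W : {set V}) k0 del : k0 \in W -> 0 < del ->
  exists f C, [/\ one_lipschitz P f,
    forall x, x \in W -> C <= Lap P f x,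
    forall x, Lap P f x <= C + del &
    forall y, y \notin W -> exists2 z, adj P y z & f z <= f y - 1].
Proof.
move=> k0W del0; pose T f := lip_ext P W k0 (lazy_step P f).
have T_lip f : one_lipschitz P f -> one_lipschitz P (T f).
  by move=> _; exact: lip_ext_lip.
have T_homo f g c : (forall x, f x <= g x + c) ->
    forall x, T f x <= T g x + c.
  by move=> fg; apply: lip_ext_homo => //; exact: lazy_step_homo.
have del2 : 0 < del / 2 by lra.
have [f fL [c Hc]] := approx_eigenfunction k0 T_lip T_homo del2.
have TfL := T_lip _ fL; have LTfL := lazy_step_lip Pker Psym Pconn curv TfL.
(* The function kept is [T f]: being an extension from [W], it descends outside [W], and applying
   [T] preserves the eigenfunction bounds. *)
have {}Hc x : c <= T (T f) x - T f x <= c + del / 2.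
  have up : T (T f) x <= T f x + (c + del / 2).
    by apply: T_homo => y; have := Hc y; lra.
  have dn : T f x <= T (T f) x + - c.
    by apply: T_homo => y; have := Hc y; lra.
  by lra.
exists (T f), (2 * c); split=> // [x xW|x|y yW].
- have := Hc x; rewrite [T (T f) x]lip_ext_id // /lazy_step; lra.
- have := lip_ext_ge k0W x LTfL; have := Hc x.
  by rewrite -/(T (T f) x) /lazy_step; lra.
- exact: lip_ext_descent.
Qed.

End Separation.

(** * Reversible measure, Green's formula and concentration *)

Section ReversibleMeasure.
Variables (R : realType) (V : finType) (P : V -> V -> R) (m : V -> R).
Hypotheses (Pker : markov_kernel P) (Psym : symmetric_support P).
Hypotheses (Pconn : connected_chain P) (mrev : reversible_prob P m).

Local Notation mu := (mass m).

Lemma mass_subset (A B : {set V}) : A \subset B -> mu A <= mu B.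
Proof.
move=> /fintype.subsetP AB; rewrite /mass big_mkcond [leRHS]big_mkcond /=.
apply: ler_sum => x _; case: ifP => [/AB -> //|_].
by case: ifP => // _; exact: mrev.1.
Qed.

Lemma massC (A : {set V}) : mu (~: A) = 1 - mu A.
Proof.
rewrite -mrev.2.1 (bigID (mem A)) /= addrC addrK /mass.
by apply: eq_bigl => x; rewrite inE.
Qed.

Lemma massU_le (A B : {set V}) : mu (A :|: B) <= mu A + mu B.
Proof.
rewrite /mass big_mkcond [X in _ <= X + _]big_mkcond [X in _ <= _ + X]big_mkcond.
rewrite -big_split /=; apply: ler_sum => x _; have := mrev.1 x; rewrite inE.
by case: (x \in A); case: (x \in B); rewrite /= ?addr0 ?add0r //; lra.
Qed.

(** Take for [s] the least value of [f] whose sublevel set has mass above [q]; the strict sublevel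
    set is empty or the sublevel set of the preceding value. *)
Lemma quantile (f : V -> R) q : 0 <= q < 1 ->
  exists s, mu [set x | f x < s] <= q < mu [set x | f x <= s].
Proof.
move=> /andP[q0 q1].
have massT : mu finset.setT = 1 by rewrite -finset.setC0 massC /mass big_set0 subr0.
have [x0 _] : exists x0 : V, true.
  case: (pickP (@predT V)) => [x _|V0]; first by exists x.
  by move: massT; rewrite /mass big_pred0 ?(eqxx, oner_eq0) => [/esym/eqP|x];
    [rewrite oner_eq0|have := V0 x].
pose good x := q < mu [set y | f y <= f x].
have [z _ zmax] := @arg_maxP _ _ _ x0 xpredT f isT.
have gz : good z.
  rewrite /good (_ : [set y | _] = finset.setT) ?massT //.
  by apply/finset.setP => y; rewrite !inE; exact: zmax.
have [w gw wmin] := @arg_minP _ _ _ z good f gz.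
exists (f w); rewrite -/(good w) gw andbT.
case: (pickP (fun x => f x < f w)) => [y yw|none]; last first.
  rewrite (_ : [set x | _] = finset.set0); first by rewrite /mass big_set0.
  by apply/finset.setP => x; rewrite !inE none.
have [v vw vmax] := @arg_maxP _ _ _ y (fun x => f x < f w) f yw.
rewrite leNgt; apply/negP => h; have /wmin : good v.
  apply: lt_le_trans h (mass_subset _); apply/fintype.subsetP => x; rewrite !inE.
  exact: vmax.
by rewrite leNgt vw.
Qed.

(** Detailed balance carries positivity across edges, hence from one vertex of positive mass to
    all. *)
Lemma m_gt0 x : 0 < m x.
Proof.
have step y z : adj P y z -> 0 < m y -> 0 < m z.
  move=> /andP[_ yz] my; have := mulr_gt0 my yz.
  rewrite mrev.2.2 => h; rewrite lt_neqAle mrev.1 andbT eq_sym.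
  by apply: contraTneq h => ->; rewrite mul0r ltxx.
have walk_pos n y : walk P n y x -> 0 < m y -> 0 < m x.
  elim: n y => [|n IH] y; first by move=> /= /eqP ->.
  by rewrite walkS => /existsP[z /andP[yz zx]] /(step _ _ yz); exact: IH zx.
have [y my] : exists y, 0 < m y.
  apply/existsP; rewrite -[X in is_true X]negbK negb_exists.
  apply/negP => /forallP all0.
  have := mrev.2.1; rewrite big1 => [/esym/eqP|y _]; first by rewrite oner_eq0.
  by apply/eqP; rewrite eq_le mrev.1 andbT leNgt all0.
by have [n /walk_pos] := Pconn y x; apply.
Qed.

Lemma mass_gt0 (W : {set V}) : W != finset.set0 -> 0 < mu W.
Proof.
case/finset.set0Pn => x xW; apply: lt_le_trans (m_gt0 x) _.
have <- : mu [set x] = m x by rewrite /mass big_set1.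
by apply: mass_subset; rewrite finset.sub1set.
Qed.

Lemma edgeC x y : m x * P x y = m y * P y x. Proof. exact: mrev.2.2. Qed.

Lemma edge_ge0 x y : 0 <= m x * P x y.
Proof. by rewrite mulr_ge0 ?mrev.1 ?Pker.1. Qed.

(** By reversibility the edge flow [a] is antisymmetric, so pairs inside [W] cancel and only the
    flow across the boundary remains. *)
Lemma Lap_boundary (W : {set V}) f C : one_lipschitz P f ->
  (forall x, x \in W -> C <= Lap P f x) -> C * mu W <= boundary P m W.
Proof.
move=> fL CLap; pose a x y := m x * P x y * (f y - f x).
have aN x y : a x y = - a y x by rewrite /a edgeC -mulrN opprB.
have inner : \sum_(x in W) \sum_(y in W) a x y = 0.
  set S := \sum_(x in W) _; suff : S = - S by lra.
  rewrite {1}/S exchange_big /= -sumrN; apply: eq_bigr => x _.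
  by rewrite -sumrN; apply: eq_bigr => y _; exact: aN.
have -> : C * mu W = \sum_(x in W) m x * C by rewrite mulrC mulr_suml.
apply: (@le_trans _ _ (\sum_(x in W) \sum_y a x y)).
  apply: ler_sum => x xW; under eq_bigr do rewrite /a -mulrA.
  by rewrite -mulr_sumr ler_wpM2l ?mrev.1 ?CLap.
have -> : \sum_(x in W) \sum_y a x y =
    \sum_(x in W) \sum_(y in W) a x y + \sum_(x in W) \sum_(y in ~: W) a x y.
  rewrite -big_split; apply: eq_bigr => x _ /=.
  by rewrite (bigID (mem W)) /=; congr (_ + _); apply: eq_bigl => y; rewrite inE.
rewrite inner add0r; apply: ler_sum => x _; apply: ler_sum => y _.
rewrite /a [P x y * _]mulrC ler_wpM2l ?edge_ge0 //.
by have := lipP y x fL; rewrite gdistC //; lra.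
Qed.

(** Splitting increments of [f] into positive and negative parts and swapping the endpoints in one
    sum keeps only descending edges. For [phi] antitone in [f] every term is then nonnegative. *)
Lemma green (f phi : V -> R) : \sum_x m x * phi x * Lap P f x =
  \sum_x \sum_y m x * P x y * (phi y - phi x) * Num.max 0 (f x - f y).
Proof.
pose c x y := m x * P x y.
have posneg x y : f y - f x = Num.max 0 (f y - f x) - Num.max 0 (f x - f y).
  by case: (lerP 0 (f y - f x)) => h; case: (lerP 0 (f x - f y)) => h'; lra.
transitivity (\sum_x \sum_y c x y * phi x * Num.max 0 (f y - f x) -
              \sum_x \sum_y c x y * phi x * Num.max 0 (f x - f y)).
  rewrite -sumrB; apply: eq_bigr => x _; rewrite /Lap mulr_sumr -sumrB.
  by apply: eq_bigr => y _; rewrite {1}posneg /c; ring.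
rewrite exchange_big -sumrB; apply: eq_bigr => x _; rewrite -sumrB.
by apply: eq_bigr => y _; rewrite /c (edgeC y x); ring.
Qed.

(* Green's formula for [psi \o f]: each [y] outside [W] contributes at least the
   edge along which [f] drops by 1. *)
Lemma level_decay (W : {set V}) (f : V -> R) (psi : R -> R) (p lam s C : R) :
  (forall x, Lap P f x <= C) ->
  (forall y, y \notin W -> exists2 z, adj P y z & f z <= f y - 1) ->
  0 <= p -> (forall x y, adj P x y -> p <= P x y) ->
  (forall t, 0 <= psi t) -> {homo psi : t u / t <= u >-> u <= t} ->
  (forall t, s <= t -> lam * psi t <= psi (t - 1) - psi t) -> 0 <= lam ->
  p * lam * (\sum_(y | (y \notin W) && (s <= f y)) m y * psi (f y)) <=
  C * \sum_x m x * psi (f x).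
Proof.
move=> LapC desc p0 pP psi0 psi_anti psi_dec lam0.
apply: (@le_trans _ _ (\sum_x m x * psi (f x) * Lap P f x)); last first.
  rewrite mulr_sumr; apply: ler_sum => x _.
  by rewrite mulrC ler_wpM2r // mulr_ge0 ?mrev.1.
rewrite green.
have term_ge0 x y :
    0 <= m x * P x y * (psi (f y) - psi (f x)) * Num.max 0 (f x - f y).
  case: (lerP 0 (f x - f y)) => h; last by rewrite mulr0.
  rewrite !mulr_ge0 ?mrev.1 ?Pker.1 // subr_ge0; apply: psi_anti; lra.
rewrite mulr_sumr big_mkcond; apply: ler_sum => y _.
case: ifP => [/andP[yW sy]|_]; last by apply: sumr_ge0 => z _.
have [z yz fz] := desc _ yW.
rewrite (bigD1 z) //= -[leLHS]addr0; apply: lerD; last exact: sumr_ge0.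
have -> : Num.max 0 (f y - f z) = f y - f z by apply/max_idPr; lra.
have gap : lam * psi (f y) <= psi (f z) - psi (f y).
  apply: le_trans (psi_dec _ sy) _; rewrite lerD2r; exact: psi_anti.
have -> : p * lam * (m y * psi (f y)) = m y * (p * (lam * psi (f y))) by ring.
rewrite -!mulrA ler_wpM2l ?mrev.1 // ler_pM ?mulr_ge0 ?pP //.
rewrite -[leLHS]mulr1; apply: ler_pM => //; last lra.
by rewrite mulr_ge0.
Qed.

Variable rho : R.
Hypothesis conc : gaussian_concentration P m rho.

Lemma concentration_separated (A B : {set V}) r : 2^-1 <= mu A -> 0 < r ->
  (forall x a, x \in B -> a \in A -> r < (gdist P x a)%:R) ->
  mu B <= expR (- (rho * r ^+ 2)).
Proof.
move=> A2 r0 sep; apply: le_trans (mass_subset _) (conc A2 r0).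
apply/fintype.subsetP => x xB; rewrite !inE negb_exists; apply/forallP => a.
by apply/negP => /andP[aA]; rewrite leNgt sep.
Qed.

End ReversibleMeasure.

(** * The exponential test function *)

Section CutoffExponential.
Variables (R : realType) (s lam : R).
Hypothesis lam0 : 0 <= lam.

(* The jump at [s] makes [psi (t - 1) - psi t >= lam * psi t] hold on all of
   [s <= t], including [s <= t < s + 1]. *)
Definition cutoff_exp (t : R) : R :=
  if t < s then 1 else expR (- (lam * (t - s + 1))).

Lemma cutoff_exp_ge0 t : 0 <= cutoff_exp t.
Proof. by rewrite /cutoff_exp; case: ifP => // _; exact: expR_ge0. Qed.

Lemma cutoff_exp_le1 t : cutoff_exp t <= 1.
Proof.
rewrite /cutoff_exp; case: ltP => // st.
by rewrite expR_le1 oppr_le0 mulr_ge0 //; lra.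
Qed.

Lemma cutoff_exp_anti : {homo cutoff_exp : t u / t <= u >-> u <= t}.
Proof.
move=> t u tu; rewrite {2}/cutoff_exp; case: ltP => [_|st].
  exact: cutoff_exp_le1.
rewrite /cutoff_exp ltNge (le_trans st tu) /= ler_expR lerN2.
by apply: ler_wpM2l => //; lra.
Qed.

(** One unit step down gains a factor of at least [expR lam], which is at least [1 + lam]. *)
Lemma cutoff_exp_decay t : s <= t ->
  lam * cutoff_exp t <= cutoff_exp (t - 1) - cutoff_exp t.
Proof.
move=> st; suff : (1 + lam) * cutoff_exp t <= cutoff_exp (t - 1) by lra.
have e0 : 0 <= cutoff_exp t by exact: cutoff_exp_ge0.
apply: (le_trans (ler_wpM2r e0 (expR_ge1Dx lam))).
rewrite /cutoff_exp ltNge st /= -expRD.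
have -> : lam - lam * (t - s + 1) = - (lam * (t - s)) by ring.
case: ltP => _; first by rewrite expR_le1 oppr_le0 mulr_ge0 // subr_ge0.
by rewrite ler_expR addrAC subrK.
Qed.

End CutoffExponential.

(** * The isoperimetric estimate *)

Section Isoperimetry.
Variables (R : realType) (V : finType) (P : V -> V -> R) (m : V -> R).
Variable rho : R.
Hypotheses (Pker : markov_kernel P) (Psym : symmetric_support P).
Hypotheses (Pconn : connected_chain P) (mrev : reversible_prob P m).
Hypotheses (curv : nonneg_curvature P) (rho0 : 0 < rho).
Hypothesis conc : gaussian_concentration P m rho.

Local Notation mu := (mass m).

Lemma boundary_ge (W : {set V}) (p : R) :
  W != finset.set0 -> mu W <= 2^-1 ->
  0 < p -> (forall x y, adj P x y -> p <= P x y) ->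
  p * (Num.sqrt rho / 48) <= boundary P m W / (mu W * Num.sqrt (ln (mu W)^-1)).
Proof.
move=> W0 W2 p0 pP; have [k0 k0W] := finset.set0Pn _ W0.
set eps := mu W in W2 *; have eps0 : 0 < eps by exact: mass_gt0.
pose l := ln eps^-1.
have expl : expR (- l) = eps by rewrite /l lnV // opprK lnK.
have /andP[ln4_gt0 ln4_le] : 0 < ln (4 : R) <= 2 * l.
  rewrite ln_gt0 ?ltr1n //=.
  rewrite (_ : 4 = 2 * 2 :> R); last by lra.
  rewrite lnM ?posrE // /l.
  have : ln (2 : R) <= ln eps^-1; last by lra.
  by rewrite ler_ln ?posrE ?invr_gt0 // -[2]invrK lef_pV2 ?posrE ?invr_gt0.
have exp4 : expR (- ln (4 : R)) = 4^-1 by rewrite expRN lnK ?posrE.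
have l0 : 0 < l by lra.
pose u := Num.sqrt (l / rho).
have u2 : rho * u ^+ 2 = l.
  by rewrite sqr_sqrtr ?divr_ge0 ?ltW // mulrC divfK // gt_eqF.
(* Distances are integers: [W] and its complement are at distance at least 1. *)
have u_ge : 2 / 3 <= u.
  have sepW x a : x \in W -> a \in ~: W -> 2 / 3 < (gdist P x a)%:R :> R.
    move=> xW aW; suff : (1 : R) <= (gdist P x a)%:R by lra.
    by rewrite ler1n gdist_gt0 //; apply: contraTneq aW => <-; rewrite inE negbK.
  have := concentration_separated mrev conc (A := ~: W) _ _ sepW.
  rewrite (massC mrev) -/eps => /(_ ltac:(lra) ltac:(lra)).
  rewrite -expl ler_expR lerN2 -u2 ler_pM2l // ler_pXn2r ?nnegrE //.
  exact: sqrtr_ge0.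
have u0 : 0 < u by lra.
(* The Gaussian bound equals [eps] at radius [u] and [eps / 4] at radius [r]. *)
pose r := Num.sqrt ((l + ln 4) / rho).
have r2 : rho * r ^+ 2 = l + ln 4.
  rewrite sqr_sqrtr; first by rewrite mulrC divfK // gt_eqF.
  by apply: divr_ge0; [lra|exact: ltW].
have r0 : 0 < r by rewrite sqrtr_gt0 divr_gt0 //; lra.
(* From [ln 4 <= 2 * l], [r ^+ 2] is at most [3 * u ^+ 2], and 3 < 49/16. With [1 <= 3 / 2 * u] this
   yields [2 * r + 1 <= 5 * u]. *)
have r_le : r <= 7 / 4 * u.
  rewrite -(@ler_pXn2r _ 2) ?nnegrE //; try lra.
  by rewrite -(ler_pM2l rho0) r2 exprMn mulrCA u2; lra.
have exp_r : expR (- (rho * r ^+ 2)) = eps / 4.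
  by rewrite r2 opprD expRD expl exp4.
(* The slack [1/80] turns the bound [1/30] obtained below into [1/48]. *)
pose del := p * rho * u / 80.
have pru0 : 0 < p * rho * u by rewrite !mulr_gt0.
have del0 : 0 < del by rewrite divr_gt0.
have [f [C [fL CW CV desc]]] :=
  laplacian_separation Pker Psym Pconn curv k0W del0.
have [|s /andP[lt_s le_s]] := quantile mrev f (q := eps / 4).
  by apply/andP; split; lra.
(* Otherwise [f > s + r] has mass at least 1/2, and concentration around it leaves at most [eps / 4]
   for [f <= s], against the choice of [s]. *)
have med : 2^-1 <= mu [set x | f x <= s + r].
  rewrite leNgt; apply/negP => h.
  have A2 : 2^-1 <= mu (~: [set x | f x <= s + r]) by rewrite (massC mrev); lra.
  have sep x a : x \in [set x | f x <= s] -> a \in ~: [set x | f x <= s + r] ->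
      r < (gdist P x a)%:R.
    rewrite !inE -ltNge => xs sa; have := lipP a x fL.
    by rewrite gdistC //; lra.
  by have := concentration_separated mrev conc A2 r0 sep; rewrite exp_r; lra.
have top : mu [set x | s + 2 * r < f x] <= eps / 4.
  rewrite -exp_r; apply: (concentration_separated mrev conc med r0) => x a.
  by rewrite !inE => xs sa; have := lipP x a fL; lra.
pose S := [set y | [&& y \notin W, s <= f y & f y <= s + 2 * r]].
have S4 : 4^-1 <= mu S.
  (* The total is [3 / 2 * eps], at most 3/4. *)
  have : mu (~: S) <= eps + (eps / 4 + eps / 4); last by rewrite (massC mrev); lra.
  apply: le_trans (_ : mu (W :|: ([set x | (f x < s)%R] :|: [set x | s + 2 * r < f x])) <= _).
    apply: (mass_subset mrev); apply/fintype.subsetP => x; rewrite !inE.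
    by case: (x \in W); case: (lerP s (f x)); case: (lerP (f x) (s + 2 * r)).
  apply: le_trans (massU_le mrev _ _) _; rewrite lerD2l.
  by apply: le_trans (massU_le mrev _ _) _; exact: lerD.
(* Since [2 * r + 1 <= 5 * u], the cutoff exponential is at least [expR (- l)],
   that is [eps], up to height [s + 2 * r]. *)
pose lam := rho * u / 5; have lam0 : 0 < lam by rewrite divr_gt0 // mulr_gt0.
pose psi := cutoff_exp s lam.
have psi0 t : 0 <= psi t by exact: cutoff_exp_ge0.
have psi1 t : psi t <= 1 by apply: cutoff_exp_le1; exact: ltW.
pose A := \sum_(y | (y \notin W) && (s <= f y)) m y * psi (f y).
have m0 := mrev.1.
have A_ge : eps / 4 <= A.
  apply: (@le_trans _ _ (eps * mu S)); first by rewrite ler_wpM2l // ltW.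
  rewrite /mass mulr_sumr /A big_mkcond [leRHS]big_mkcond /=.
  apply: ler_sum => y _; rewrite inE.
  case: (y \notin W) => //=; case: (lerP s (f y)) => //= sy.
  case: ifP => [ys|_]; last by rewrite mulr_ge0.
  rewrite mulrC ler_wpM2l // /psi /cutoff_exp ltNge sy /= -expl ler_expR lerN2.
  have : lam * (f y - s + 1) <= lam * (5 * u) by rewrite ler_wpM2l ?(ltW lam0) //; lra.
  by rewrite -u2 /lam; lra.
(* As [psi <= 1], [W] costs at most [eps] and the points with [f < s] at most [eps / 4]. *)
have total : \sum_x m x * psi (f x) <= A + (eps + eps / 4).
  apply: (@le_trans _ _ (A + (mu W + mu [set x | f x < s]))); last first.
    by rewrite !lerD2l.
  rewrite /A /mass [X in _ <= X + _]big_mkcond [X in _ <= _ + (X + _)]big_mkcond.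
  rewrite [X in _ <= _ + (_ + X)]big_mkcond -!big_split /=.
  apply: ler_sum => x _; rewrite inE.
  have mpsi : m x * psi (f x) <= m x by rewrite ler_piMr.
  have := m0 x; have : 0 <= m x * psi (f x) by rewrite mulr_ge0.
  by case: (x \in W); case: (lerP s (f x)) => /= *; lra.
have decay : p * lam * A <= (C + del) * \sum_x m x * psi (f x).
  apply: (level_decay Pker mrev CV desc) => //; try exact: ltW.
  - by apply: cutoff_exp_anti; exact: ltW.
  - by move=> t; apply: cutoff_exp_decay; exact: ltW.
have CW_le := Lap_boundary Pker Psym Pconn mrev fL CW.
have plam0 : 0 < p * lam by rewrite mulr_gt0.
have C_ge : p * lam / 6 <= C + del.
  have A0 : 0 < A by lra.
  have pA : 0 < p * lam * A by rewrite mulr_gt0.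
  have T0 : 0 <= \sum_x m x * psi (f x) by apply: sumr_ge0 => x _; rewrite mulr_ge0.
  have Cd0 : 0 < C + del by nra.
  (* The 6 is 1 + 5: [A >= eps / 4] bounds [eps + eps / 4] by [5 * A]. *)
  have : p * lam * A <= (C + del) * (6 * A).
    apply: le_trans decay _; apply: ler_wpM2l; first exact: ltW.
    by apply: le_trans total _; lra.
  by rewrite mulrA ler_pM2r // => ?; lra.
have C48 : p * rho * u / 48 <= C.
  have : p * lam / 6 = p * rho * u / 30 by rewrite /lam; field.
  by move=> e; rewrite e /del in C_ge; lra.
have sq : Num.sqrt rho * Num.sqrt l = rho * u.
  rewrite -sqrtrM ?(ltW rho0) //.
  have -> : rho * l = (rho * u) ^+ 2 by rewrite -u2; ring.
  by rewrite sqrtr_sqr ger0_norm // mulr_ge0 ?ltW.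
have sl0 : 0 < Num.sqrt l by rewrite sqrtr_gt0.
rewrite -/l ler_pdivlMr; last by rewrite mulr_gt0.
apply: le_trans CW_le; rewrite -/eps.
have -> : p * (Num.sqrt rho / 48) * (eps * Num.sqrt l) =
  (p * rho * u / 48) * eps by rewrite -[p * rho * u]mulrA -sq; field.
by rewrite ler_wpM2r // ltW.
Qed.

End Isoperimetry.

Theorem theorem6p6 (R : realType) (V : finType) (P : V -> V -> R) (m : V -> R)
  (rho : R) :
  markov_kernel P -> symmetric_support P -> connected_chain P ->
  reversible_prob P m -> nonneg_curvature P ->
  0 < rho -> gaussian_concentration P m rho ->
  (P0 P * (Num.sqrt rho / 48)%:E <= h_sqrtlog P m)%E.
Proof.
move=> Pker Psym Pconn mrev curv rho0 conc.
apply: le_ereal_inf_tmp => _ [W [W0 W2] <-].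
have [k kW] := finset.set0Pn _ W0.
(* A point outside [W] and one inside it provide an edge, so [P] attains its minimum over edges. *)
have [z zW] : exists z, z \notin W.
  apply/existsP; rewrite -[X in is_true X]negbK negb_exists.
  apply/negP => /forallP Wall.
  have WT : ~: W = finset.set0.
    by apply/finset.setP => x; rewrite !inE; have := Wall x; rewrite negbK => ->.
  have := massC mrev W; rewrite WT {1}/mass big_set0; lra.
have zk : z != k by apply: contraNneq zW => ->.
have [w zw _] := gdist_step Pconn zk.
have [[x y] /= xy pmin] := @arg_minP _ _ _ (z, w)
  (fun e => adj P e.1 e.2) (fun e => P e.1 e.2) zw.
have p0 : 0 < P x y by case/andP: xy.
(* The extended real [P0] is at most the finite value at the minimising edge, whose length is 1. *)
apply: (@le_trans _ _ ((P x y)%:E * (Num.sqrt rho / 48)%:E)%E).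
  apply: lee_wpmul2r; first by rewrite lee_fin divr_ge0 ?sqrtr_ge0.
  apply: ereal_inf_lbound; exists (x, y) => //=.
  by rewrite (adj_gdist Pconn xy) expr1n mulr1.
rewrite -EFinM lee_fin.
apply: (boundary_ge Pker Psym Pconn mrev curv rho0 conc) => // a b ab.
exact: (pmin (a, b)).
Qed.
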